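(* Suppose that the linear system $$\begin{bmatrix} \dot{I}^m \\ \dot{U}^d \end{bmatrix}=\begin{bmatrix} -D^{-1}(E+YR) & D^{-1}Y \\ -\Psi L \Upsilon^{-1}+\Phi L \Upsilon^{-1} D^{-1}(E+YR) & -\Phi L \Upsilon^{-1}D^{-1}Y \end{bmatrix}\begin{bmatrix} I^m \\ U^d \end{bmatrix}$$ is semistable. Then it reaches current sharing in the sense that in steady state (as $t\to\infty$) all nodes have the same current ratio $i_k^r=i_k^m/I_k^{max}=r_{c1}$ for all $k\in\mathcal{N}$, where $$r_{c1}=\begin{cases}\dfrac{\underline{1}_n^T\Psi^{-1}\big(U^d(0)+\Phi L\Upsilon^{-1}I^m(0)\big)}{\underline{1}_n^T\Psi^{-1}(Y^{-1}+R)\Upsilon\underline{1}_n}, & \text{if } Y_s\ne 0,\\[2mm] 0,&\text{if } Y_s=0.\end{cases}$$ Moreover, the (steady-state) output voltage vector $U$ of the nodes is given by $$U=\begin{cases} r_{c1}Y^{-1}\Upsilon\underline{1}_n,&\text{if }Y_s\ne 0,\\ r_{c2}\underline{1}_n,&\text{if }Y_s=0,\end{cases}\qquad\text{where}\quad r_{c2}=\frac{\underline{1}_n^T\Psi^{-1}\big(U^d(0)+\Phi L\Upsilon^{-1}I^m(0)\big)}{\underline{1}_n^T\Psi^{-1}\underline{1}_n}.$$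
   Context: Network. Let $\mathcal{N}=\{1,\dots,n\}$ be the set of generator nodes of a DC microgrid. Branch conductances $G_{kj}=G_{jk}\ge 0$ ($k\ne j$) and shunt conductances $G_{kk}\ge 0$ are given. The conductance matrix is $Y=[Y_{kj}]=Y_s+Y_c\in\mathbb{R}^{n\times n}$, with $Y_s=\mathrm{diag}(G_{11},\dots,G_{nn})$ and $Y_c$ the symmetric matrix with off-diagonal entries $-G_{kj}$ and diagonal entries $\sum_{j\ne k}G_{kj}$. Information graph Laplacian. $L=(l_{ij})\in\mathbb{R}^{n\times n}$ has, for $i\neq j$, $l_{ij}=-1$ if $Y_{ij}\ne 0$ and $l_{ij}=0$ otherwise, and $l_{ii}=-\sum_{j\ne i}l_{ij}$. Parameters. $E$ is the identity matrix; $\underline{1}_n\in\mathbb{R}^n$ is the all-ones vector; $D=\mathrm{diag}(\tau_1,\dots,\tau_n)$ with filter time constants $\tau_k>0$; $R=\mathrm{diag}(R_1,\dots,R_n)$ with virtual resistances $R_k>0$; $\Upsilon=\mathrm{diag}(I_1^{max},\dots,I_n^{max})$ with maximum currents $I_k^{max}>0$; $\Phi=\mathrm{diag}(\alpha_1,\dots,\alpha_n)$ with proportional gains $\alpha_k>0$; $\Psi=\mathrm{diag}(\beta_1,\dots,\beta_n)$ with integrator gains $\beta_k>0$. State. $I^m=(i_1^m,\dots,i_n^m)^T$ is the vector of measured (low-pass filtered) output currents and $U^d\in\mathbb{R}^n$ is the vector of rated output voltages, with initial values $I^m(0)$ and $U^d(0)$; the output voltage vector is $U(t)=U^d(t)-RI^m(t)$,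 and the steady-state output voltage is its limit as $t\to\infty$. Semistability. A linear system $\dot z=Az$ is semistable if $\lim_{t\to\infty}z(t)$ exists for every initial condition $z(0)$.
   Formalization: The network of nonzero branch conductances is additionally assumed to be connected; without this the claim fails (e.g. two isolated nodes, each with a shunt, keep different current ratios). *)

(* Defs.v *)
From HB Require Import structures.
From mathcomp Require Import all_boot all_order all_algebra.
From mathcomp Require Import all_classical all_reals all_analysis.
Set Implicit Arguments.
Unset Strict Implicit.
Unset Printing Implicit Defensive.
Import Order.TTheory GRing.Theory Num.Theory.
Import numFieldNormedType.Exports.
Local Open Scope classical_set_scope.
Local Open Scope ring_scope.

Section LinearSystem.
Variables (R : realType) (m : nat) (A : 'M[R]_m).

(* z solves dz/dt = A z on [0, +oo[ with initial value z 0; its values at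
   negative times are irrelevant. *)
Definition is_solution (z : R -> 'cV[R]_m) : Prop :=
  {within `[0, +oo[, continuous z} /\
  forall t : R, 0 < t -> is_derive t 1 z (A *m z t).

(* Every initial condition has exactly one solution, so quantifying over all
   solutions is quantifying over all initial conditions. *)
Definition semistable : Prop :=
  forall z : R -> 'cV[R]_m, is_solution z -> cvg (z t @[t --> +oo]).

End LinearSystem.

Section Network.
Variables (R : realType) (n : nat).

(* G k j (k != j) is the branch conductance between k and j, and G k k is the
   shunt conductance at k. *)
Definition shunt_mx (G : 'M[R]_n) : 'M[R]_n := diag_mx (\row_k G k k).

Definition branch_mx (G : 'M[R]_n) : 'M[R]_n :=
  \matrix_(k, j) (if k == j then \sum_(i | i != k) G k i else - G k j).

Definition conductance_mx (G : 'M[R]_n) : 'M[R]_n := shunt_mx G + branch_mx G.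

Definition network_connected (G : 'M[R]_n) : Prop :=
  forall k j : 'I_n, connect [rel a b | (a != b) && (G a b != 0)] k j.

Definition info_laplacian (Y : 'M[R]_n) : 'M[R]_n :=
  let l i j : R := if Y i j != 0 then -1 else 0 in
  \matrix_(i, j) (if i == j then - \sum_(k | k != i) l i k else l i j).

Definition ones : 'cV[R]_n := const_mx 1.

End Network.

Arguments ones {R n}.

Section Microgrid.
Variables (R : realType) (n : nat) (G : 'M[R]_n).
(* time constants, virtual resistances, maximum currents, proportional gains,
   integrator gains *)
Variables (tau res imax alpha beta : 'rV[R]_n).

Let Y := conductance_mx G.
Let L := info_laplacian Y.
Let D := diag_mx tau.
Let Rv := diag_mx res.
Let Ups := diag_mx imax.
Let Phi := diag_mx alpha.
Let Psi := diag_mx beta.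

Definition system_mx : 'M[R]_(n + n) :=
  block_mx
    (- (invmx D *m (1%:M + Y *m Rv)))
    (invmx D *m Y)
    (- (Psi *m L *m invmx Ups)
       + Phi *m L *m invmx Ups *m invmx D *m (1%:M + Y *m Rv))
    (- (Phi *m L *m invmx Ups *m invmx D *m Y)).

Definition ratio_num (Im0 Ud0 : 'cV[R]_n) : R :=
  (ones^T *m invmx Psi *m (Ud0 + Phi *m L *m invmx Ups *m Im0)) 0 0.

Definition rc1_den : R :=
  (ones^T *m invmx Psi *m (invmx Y + Rv) *m Ups *m ones) 0 0.

Definition rc2_den : R := (ones^T *m invmx Psi *m ones) 0 0.

Definition rc1 (Im0 Ud0 : 'cV[R]_n) : R :=
  if shunt_mx G != 0 then ratio_num Im0 Ud0 / rc1_den else 0.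

Definition rc2 (Im0 Ud0 : 'cV[R]_n) : R := ratio_num Im0 Ud0 / rc2_den.

Definition steady_voltage (Im0 Ud0 : 'cV[R]_n) : 'cV[R]_n :=
  if shunt_mx G != 0 then rc1 Im0 Ud0 *: (invmx Y *m Ups *m ones)
  else rc2 Im0 Ud0 *: ones.

End Microgrid.

(* Main.v *)
Require Import Defs.
From HB Require Import structures.
From mathcomp Require Import all_boot all_order all_algebra.
From mathcomp Require Import all_classical all_reals all_analysis.
From mathcomp Require Import lra.
Set Implicit Arguments.
Unset Strict Implicit.
Unset Printing Implicit Defensive.
Import Order.TTheory GRing.Theory Num.Theory.
Import numFieldNormedType.Exports.
Local Open Scope classical_set_scope.
Local Open Scope ring_scope.

(* The limit l of a solution of z' = A z is an equilibrium. The equations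
   A l = 0 reduce to I = Y (U^d - R I) and L Upsilon^-1 I = 0, and since the
   information graph is connected the latter forces I = r Upsilon 1. The value
   of r (or of the common voltage when Y_s = 0) is read off the conserved
   quantity 1^T Psi^-1 (U^d + Phi L Upsilon^-1 I), using 1^T L = 0. When
   Y_s <> 0, the minimum principle for Y gives both the invertibility of Y and
   the nonnegativity of Y^-1, hence a positive denominator in r_c1; when
   Y_s = 0, 1^T Y = 0 forces r = 0. *)

(** * Diagonal matrices and positivity of weighted sums *)

Section DiagonalMatrix.
Variables (R : realType) (n : nat).
Implicit Types (d : 'rV[R]_n) (x : 'cV[R]_n).

Lemma diag_mxE d x k : (diag_mx d *m x) k 0 = d 0 k * x k 0.
Proof. by rewrite mul_diag_mx mxE. Qed.

Lemma diag_mx_unit d : (forall k, d 0 k != 0) -> diag_mx d \in unitmx.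
Proof.
by move=> d0; rewrite unitmxE det_diag unitfE; apply/prodf_neq0 => k _.
Qed.

Lemma invmx_diag d : (forall k, d 0 k != 0) ->
  invmx (diag_mx d) = diag_mx (\row_k (d 0 k)^-1).
Proof.
move=> d0; apply: (row_free_inj (A := diag_mx d)).
  by rewrite row_free_unit diag_mx_unit.
rewrite /= mulVmx ?diag_mx_unit// mulmx_diag -diag_const_mx; congr diag_mx.
by apply/rowP => k; rewrite !mxE mulVf.
Qed.

Lemma ones_dot_gt0 x : (0 < n)%N -> (forall k, 0 < x k 0) ->
  0 < (ones^T *m x) 0 0.
Proof.
move=> n0 x0; rewrite mxE; under eq_bigr do rewrite !mxE mul1r.
by rewrite (bigD1 (Ordinal n0))//= ltr_pwDl// sumr_ge0// => k _; exact: ltW.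
Qed.

Lemma ones_invmx_diag_gt0 d x : (0 < n)%N -> (forall k, 0 < d 0 k) ->
  (forall k, 0 < x k 0) -> 0 < (ones^T *m invmx (diag_mx d) *m x) 0 0.
Proof.
move=> n0 d0 x0; rewrite invmx_diag => [|k]; last by rewrite gt_eqF.
rewrite -mulmxA ones_dot_gt0// => k.
by rewrite diag_mxE mxE mulr_gt0// invr_gt0.
Qed.

End DiagonalMatrix.

(** * Graph Laplacians, the minimum principle and the conductance matrix *)

Section WeightedLaplacian.
Variables (R : realType) (n : nat).
Implicit Types (W G : 'M[R]_n) (x : 'cV[R]_n).

Lemma branch_mxE W x k :
  (branch_mx W *m x) k 0 = \sum_(j | j != k) W k j * (x k 0 - x j 0).
Proof.
rewrite mxE (bigD1 k)//= !mxE eqxx mulr_suml -big_split /=.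
apply: eq_bigr => j jk; rewrite mxE eq_sym (negbTE jk).
by rewrite mulrBr mulNr.
Qed.

Lemma branch_mx_ones W : branch_mx W *m ones = 0.
Proof.
apply/colP => k; rewrite branch_mxE [RHS]mxE big1// => j _.
by rewrite !mxE subrr mulr0.
Qed.

Lemma tr_branch_mx W : (forall k j, W k j = W j k) ->
  (branch_mx W)^T = branch_mx W.
Proof.
move=> sW; apply/matrixP => i j; rewrite !mxE eq_sym.
by case: eqP => [->//|_]; rewrite sW.
Qed.

Lemma ones_branch_mx W : (forall k j, W k j = W j k) ->
  ones^T *m branch_mx W = 0.
Proof.
by move=> sW; rewrite -(tr_branch_mx sW) -trmx_mul branch_mx_ones trmx0.
Qed.

Lemma col_min_exists x : (0 < n)%N -> exists k0, forall k, x k0 0 <= x k 0.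
Proof.
case: n x => // m x _.
have [k0 _ k0_min] := @Order.TotalTheory.arg_minP _ _ _ ord0 xpredT
  (fun k => x k 0) isT.
by exists k0 => k; exact: k0_min.
Qed.

(* Minimum principle: at a minimum every term of the balance is nonpositive,
   so all of them vanish and the minimum is attained at all the neighbours. *)
Lemma min_principle W (s : 'I_n -> R) x k0 :
  (forall k j, 0 <= W k j) -> network_connected W ->
  (forall k, x k0 0 <= x k 0) ->
  (forall k, 0 <= s k * x k 0 + \sum_(j | j != k) W k j * (x k 0 - x j 0)) ->
  (forall k, s k * x k0 0 <= 0) ->
  forall k, x k 0 = x k0 0 /\ s k * x k0 0 = 0.
Proof.
move=> W0 Wc xmin bal smin.
have at_min k : x k 0 = x k0 0 ->
    s k * x k0 0 = 0 /\ forall j, (k != j) && (W k j != 0) -> x j 0 = x k0 0.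
  move=> xk; have := bal k; rewrite xk.
  have le0 j : j != k -> W k j * (x k0 0 - x j 0) <= 0.
    by move=> _; rewrite mulr_ge0_le0// subr_le0.
  have S0 : \sum_(j | j != k) W k j * (x k0 0 - x j 0) <= 0 by exact: sumr_le0.
  move=> tot.
  have s0 : s k * x k0 0 = 0.
    by apply/eqP; rewrite eq_le smin/= (le_trans tot)// gerDl.
  split=> // j /andP[kj Wkj].
  move: tot; rewrite s0 add0r => tot.
  have : \sum_(j | j != k) W k j * (x j 0 - x k0 0) == 0.
    rewrite -oppr_eq0 -sumrN.
    under eq_bigr do rewrite -mulrN opprB.
    by rewrite eq_le S0 tot.
  rewrite psumr_eq0 => [|i _]; last by rewrite mulr_ge0// subr_ge0.
  move=> /allP/(_ j (mem_index_enum _)).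
  by rewrite eq_sym kj /= mulf_eq0 (negbTE Wkj) subr_eq0 => /eqP.
have all_min k : x k 0 = x k0 0.
  have /connectP[p ep ->] := Wc k0 k.
  (* This trivial equality becomes the induction invariant: the current start of the path is a
     minimiser, while the reference value [x k0 0] stays fixed. *)
  have : x k0 0 = x k0 0 by [].
  elim: p {1 2 4}k0 ep => [|b p IH] a //= /andP[ab bp] xa.
  by apply: IH => //; apply: (at_min a xa).2.
by move=> k; split => //; apply: (at_min k (all_min k)).1.
Qed.

(** Minimum principle with zero shunt terms: a kernel vector equals its minimum at every node. *)
Lemma branch_mx_ker W x : (0 < n)%N -> (forall k j, 0 <= W k j) ->
  network_connected W -> branch_mx W *m x = 0 -> exists c, x = c *: ones.
Proof.
move=> n0 W0 Wc Wx; have [k0 xmin] := col_min_exists x n0.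
exists (x k0 0); apply/colP => k; rewrite !mxE mulr1.
apply: (min_principle (s := fun=> 0) W0 Wc xmin _ _ k).1 => j.
  by rewrite mul0r add0r -branch_mxE Wx [leRHS]mxE.
by rewrite mul0r.
Qed.

(** With 0/1 weights the information Laplacian is a branch matrix, so the kernel and column-sum
    results for [branch_mx] apply to it. *)
Lemma info_laplacianE (Y : 'M[R]_n) :
  info_laplacian Y = branch_mx (\matrix_(i, j) (Y i j != 0)%:R).
Proof.
apply/matrixP => i j; rewrite !mxE -sumrN.
case: eqP => _; last by case: eqP => _; rewrite ?oppr0.
by apply: eq_bigr => k _; rewrite mxE; case: eqP => _; rewrite ?opprK ?oppr0.
Qed.

Lemma conductance_mx_offdiag G i j : i != j -> conductance_mx G i j = - G i j.
Proof. by move=> ij; rewrite !mxE (negbTE ij) mulr0n add0r. Qed.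

Lemma conductance_mxE G x k : (conductance_mx G *m x) k 0 =
  G k k * x k 0 + \sum_(j | j != k) G k j * (x k 0 - x j 0).
Proof. by rewrite mulmxDl mxE diag_mxE branch_mxE mxE. Qed.

Lemma tr_conductance_mx G : (forall k j, G k j = G j k) ->
  (conductance_mx G)^T = conductance_mx G.
Proof. by move=> sG; rewrite linearD /= tr_diag_mx tr_branch_mx. Qed.

(** Off the diagonal [conductance_mx G] is [- G], so every edge of the network is an edge of the
    information graph, which is therefore connected. *)
Lemma info_laplacian_ker G x : (0 < n)%N -> network_connected G ->
  info_laplacian (conductance_mx G) *m x = 0 -> exists c, x = c *: ones.
Proof.
move=> n0 Gc; rewrite info_laplacianE; apply: branch_mx_ker => //.
  by move=> k j; rewrite mxE ler0n.
move=> k j; apply: connect_sub (Gc k j) => a b /andP[ab Gab].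
by rewrite connect1//= ab mxE conductance_mx_offdiag// oppr_eq0 Gab oner_eq0.
Qed.

Lemma ones_info_laplacian G : (forall k j, G k j = G j k) ->
  ones^T *m info_laplacian (conductance_mx G) = 0.
Proof.
move=> sG; rewrite info_laplacianE ones_branch_mx// => i j.
by rewrite [LHS]mxE [RHS]mxE -[in LHS](tr_conductance_mx sG) [_^T _ _]mxE.
Qed.

(** If the minimum of [x] were negative, the minimum principle with [s k = G k k] would make every
    shunt conductance vanish. *)
Lemma conductance_mx_ge0 G x : (forall k j, 0 <= G k j) ->
  network_connected G -> shunt_mx G != 0 ->
  (forall k, 0 <= (conductance_mx G *m x) k 0) -> forall k, 0 <= x k 0.
Proof.
move=> G0 Gc sG Yx k.
have [k0 xmin] := col_min_exists x (leq_ltn_trans (leq0n k) (ltn_ord k)).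
rewrite (le_trans _ (xmin k))// leNgt; apply: contra sG => xk0.
apply/eqP/matrixP => i j; rewrite !mxE; case: eqP => // _; rewrite mulr1n.
have /= [|l|_ /eqP] := min_principle (s := fun k => G k k) G0 Gc xmin _ _ i.
- by move=> l; rewrite -conductance_mxE.
- by rewrite mulr_ge0_le0// ltW.
by rewrite mulf_eq0 (lt_eqF xk0) orbF => /eqP.
Qed.

(** A kernel vector and its opposite are both nonnegative by [conductance_mx_ge0]; symmetry turns
    the left kernel into the right one. *)
Lemma conductance_mx_unit G : (forall k j, G k j = G j k) ->
  (forall k j, 0 <= G k j) -> network_connected G -> shunt_mx G != 0 ->
  conductance_mx G \in unitmx.
Proof.
move=> sG G0 Gc G_neq0; rewrite -row_free_unit; apply: inj_row_free => v.
move=> /(congr1 trmx); rewrite trmx_mul tr_conductance_mx// trmx0 => Yv.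
apply/rowP => k; rewrite -(trmxK v) [LHS]mxE [RHS]mxE.
have ge0 (x : 'cV[R]_n) : conductance_mx G *m x = 0 -> 0 <= x k 0.
  by move=> Yx; apply: conductance_mx_ge0 => // i; rewrite Yx [leRHS]mxE.
apply/eqP; rewrite eq_le ge0// andbT -oppr_ge0.
by have := ge0 (- v^T); rewrite mulmxN Yv oppr0 => /(_ erefl); rewrite mxE.
Qed.

End WeightedLaplacian.

(** * Entrywise limits of matrices *)

Section MatrixLimits.
Variables (R : realType) (T : Type) (F : set_system T).
Context {FF : Filter F}.

Lemma cvg_mxP m n (f : T -> 'M[R]_(m, n)) (M : 'M[R]_(m, n)) :
  f @ F --> M <-> forall i j, f t i j @[t --> F] --> M i j.
Proof.
split=> [fM i j|fM A [P PM PA]].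
  exact: continuous_cvg (@coord_continuous _ _ _ i j M) fM.
suff : \forall t \near F, forall i j, P i j (f t i j).
  by apply: filterS => t Pt; apply: PA.
apply: filter_forall => i; apply: filter_forall => j.
exact: fM (PM i j).
Qed.

Lemma cvg_mulmx m n p (B : 'M[R]_(m, n)) (f : T -> 'M[R]_(n, p)) M :
  f @ F --> M -> B *m f t @[t --> F] --> B *m M.
Proof.
move=> /cvg_mxP fM; apply/cvg_mxP => i j.
under eq_cvg do rewrite mxE; rewrite mxE.
by apply: cvg_big => [|k _]; [exact: add_continuous|exact: cvgMl_tmp].
Qed.

Lemma cvg_functional m (w : 'rV[R]_m) (f : T -> 'cV[R]_m) v :
  f @ F --> v -> (w *m f t) 0 0 @[t --> F] --> (w *m v) 0 0.
Proof. by move=> fv; apply: (cvg_mxP _ _).1; exact: cvg_mulmx. Qed.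

End MatrixLimits.

(** * Limits and conserved quantities of linear systems *)

Section LinearSystem.
Variables (R : realType) (m : nat) (A : 'M[R]_m) (z : R -> 'cV[R]_m).
Hypothesis z_sol : is_solution A z.
Implicit Type w : 'rV[R]_m.

(** A linear functional commutes with difference quotients and passes to their limit. *)
Lemma is_derive_functional w (t : R) : 0 < t ->
  is_derive t 1 (fun s : R => (w *m z s) 0 0) ((w *m (A *m z t)) 0 0).
Proof.
move=> /z_sol.2 [/cvg_ex[l zl] <-].
have wl : h^-1 *: ((w *m z (h *: 1 + t)) 0 0 - (w *m z t) 0 0) @[h --> 0^'] -->
    (w *m l) 0 0.
  apply: cvg_trans (cvg_functional zl); apply: near_eq_cvg.
  by apply: filterE => h /=; rewrite -scalemxAr mulmxBr !mxE.
have -> : 'D_1 z t = l by exact: cvg_lim zl.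
apply: DeriveDef; first by apply/cvg_ex; exists ((w *m l) 0 0).
exact: cvg_lim wl.
Qed.

(** The mean value theorem needs real values, hence the functional [w]. Continuity up to 0 allows
    [a = 0]. *)
Lemma functional_MVT w (a b : R) : 0 <= a -> a < b ->
  exists2 c, c \in `]a, b[ &
    (w *m z b) 0 0 - (w *m z a) 0 0 = (w *m (A *m z c)) 0 0 * (b - a).
Proof.
move=> a0 ab; apply: (MVT (f := fun s : R => (w *m z s) 0 0)
  (df := fun s => (w *m (A *m z s)) 0 0)) => // [s|].
  rewrite in_itv => /andP[/(le_lt_trans a0) s0 _].
  exact: is_derive_functional.
have sub : `[a, b]%classic `<=` `[0, +oo[%classic.
  by move=> s /=; rewrite !in_itv /= andbT => /andP[/(le_trans a0)].
move=> s; apply: cvg_functional.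
exact: (@continuous_subspaceW R 'cV[R]_m _ _ _ sub z_sol.1 s).
Qed.

(* The increment of a coordinate over [t, t + 1] is the derivative at an
   intermediate point, hence tends both to 0 and to the coordinate of A l. *)
Lemma solution_limit_ker l : z t @[t --> +oo] --> l -> A *m l = 0.
Proof.
move=> zl; apply/matrixP => i j; rewrite !ord1 [RHS]mxE {j}.
pose w := delta_mx 0 i : 'rV[R]_m.
have wE (v : 'cV[R]_m) : (w *m v) 0 0 = v i 0 by rewrite -rowE mxE.
have wz : (w *m z t) 0 0 @[t --> +oo] --> (w *m l) 0 0.
  exact: cvg_functional.
have wAz : (w *m (A *m z t)) 0 0 @[t --> +oo] --> (w *m (A *m l)) 0 0.
  by apply: cvg_functional; exact: cvg_mulmx.
rewrite -wE; apply/eqP; rewrite -normr_le0; apply/ler_addgt0Pl => e e0.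
rewrite addr0.
(* Three errors add up: the functional at [t], at [t + 1], and its derivative at the intermediate
   point. *)
have e3 : 0 < e / 3 by rewrite divr_gt0.
have [M1 [_ wzM]] := (cvgrPdist_lt _ _).1 wz _ e3.
have [M2 [_ wAzM]] := (cvgrPdist_lt _ _).1 wAz _ e3.
pose t := Num.max 0 (Num.max M1 M2) + 1.
have maxt : Num.max 0 (Num.max M1 M2) < t by rewrite ltrDl ltr01.
move: maxt; rewrite !gt_max => /and3P[t0 M1t M2t].
have tt1 : t < t + 1 by rewrite ltrDl ltr01.
have [c] := functional_MVT w (ltW t0) tt1.
rewrite in_itv/= => /andP[tc _]; rewrite [t + 1]addrC addrK mulr1 => fc.
have /= := wzM t M1t; have /= := wzM (t + 1) (lt_trans M1t tt1).
have /= := wAzM c (lt_trans M2t tc); rewrite -fc [1 + t]addrC.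
rewrite !ltr_norml ler_norml; lra.
Qed.

(** The derivative of [w *m z] is [w *m A *m z = 0], so the mean value theorem from time 0 makes it
    constant; its limit is then its initial value. *)
Lemma conserved_functional w l : w *m A = 0 -> z t @[t --> +oo] --> l ->
  w *m l = w *m z 0.
Proof.
move=> wA zl; apply/matrixP => i j; rewrite !ord1.
have wz t : 0 < t -> (w *m z t) 0 0 = (w *m z 0) 0 0.
  move=> t0; apply/eqP; rewrite -subr_eq0; apply/eqP.
  have [c] := functional_MVT w (lexx 0) t0.
  by move=> _ ->; rewrite mulmxA wA mul0mx mxE mul0r.
have wl : (w *m z t) 0 0 @[t --> +oo] --> (w *m l) 0 0.
  exact: cvg_functional.
rewrite -(cvg_lim _ wl)//; apply: cvg_lim => //; apply: cvg_near_cst.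
by near=> t; apply: wz; near: t; exact: nbhs_pinfty_gt.
Unshelve. all: by end_near. Qed.

End LinearSystem.

(** * Equilibria and conserved quantity of the microgrid *)

Section Microgrid.
Variables (R : realType) (n : nat) (G : 'M[R]_n).
Variables (tau res imax alpha beta : 'rV[R]_n).
Hypothesis tau_neq0 : forall k, tau 0 k != 0.
Hypothesis beta_neq0 : forall k, beta 0 k != 0.

Let Y := conductance_mx G.
Let L := info_laplacian Y.
Let Rv := diag_mx res.
Let Ups := diag_mx imax.
Let Phi := diag_mx alpha.
Let Psi := diag_mx beta.
Let A := system_mx G tau res imax alpha beta.

(** The first block row gives [D^-1 (E + Y R) I = D^-1 Y U^d]. Substituted in the second, it cancels
    the [Phi] terms and leaves [Psi L Ups^-1 I = 0]. *)
Lemma system_mx_ker (Im Ud : 'cV[R]_n) : A *m col_mx Im Ud = 0 ->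
  Im = Y *m (Ud - Rv *m Im) /\ L *m (invmx Ups *m Im) = 0.
Proof.
rewrite mul_block_col -[0]vsubmxK => /eq_col_mx[].
rewrite linear0 linear0 => E1 E2.
have E : invmx (diag_mx tau) *m (1%:M + Y *m Rv) *m Im =
    invmx (diag_mx tau) *m Y *m Ud.
  by apply/eqP; rewrite eq_sym -subr_eq0 -mulNmx addrC; apply/eqP.
split.
  move: E; rewrite -!mulmxA => /(can_inj (mulKVmx (diag_mx_unit tau_neq0))).
  rewrite mulmxDl mul1mx -!mulmxA mulmxBr => <-.
  by rewrite addrK.
apply: (can_inj (mulKmx (diag_mx_unit beta_neq0))).
apply/eqP; rewrite mulmx0 -oppr_eq0; apply/eqP; rewrite -[RHS]E2.
rewrite mulmxDl !mulNmx -!mulmxA.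
move: E; rewrite -!mulmxA => ->.
by rewrite addrK.
Qed.

(** The [Phi] terms of the two block rows cancel; what remains is [- 1^T L Ups^-1], zero because the
    columns of [L] sum to zero. *)
Lemma system_mx_conserved : (forall k j, G k j = G j k) ->
  row_mx (ones^T *m invmx Psi *m (Phi *m L *m invmx Ups))
         (ones^T *m invmx Psi) *m A = 0.
Proof.
move=> sG; rewrite mul_row_block -[RHS]hsubmxK !linear0; congr row_mx.
  (* Abstracting [1 + Y R] keeps distributivity from splitting it. *)
  rewrite -/Y -/L -/Rv -/Ups -/Phi -/Psi; move: (1%:M + Y *m Rv) => M.
  rewrite mulmxDr !mulmxN !mulmxA mulmxKV ?diag_mx_unit//.
  by rewrite [ones^T *m L]ones_info_laplacian// mul0mx oppr0 add0r addNr.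
by rewrite !mulmxN !mulmxA subrr.
Qed.

End Microgrid.

(** The vector [(Y^-1 + R) Ups 1] is entrywise positive: [R Ups 1] is positive, and [Y^-1 Ups 1] is
    nonnegative since [Y] maps it to the positive vector [Ups 1]. *)
Lemma rc1_den_gt0 (R : realType) n (G : 'M[R]_n) (res imax beta : 'rV[R]_n) :
  (0 < n)%N -> (forall k j, G k j = G j k) -> (forall k j, 0 <= G k j) ->
  network_connected G -> shunt_mx G != 0 -> (forall k, 0 < res 0 k) ->
  (forall k, 0 < imax 0 k) -> (forall k, 0 < beta 0 k) ->
  0 < rc1_den G res imax beta.
Proof.
move=> n0 sG G0 Gc Gs res0 imax0 beta0; rewrite /rc1_den -2!mulmxA.
apply: ones_invmx_diag_gt0 => // k.
rewrite mulmxDl mxE addrC ltr_pwDl//.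
  by rewrite !diag_mxE mxE mulr1 mulr_gt0.
apply: (conductance_mx_ge0 G0 Gc Gs) => j.
by rewrite mulKVmx ?conductance_mx_unit// diag_mxE mxE mulr1 ltW.
Qed.

Theorem theorem2 (R : realType) (n : nat) (G : 'M[R]_n)
    (tau res imax alpha beta : 'rV[R]_n) (Im Ud : R -> 'cV[R]_n) :
  (0 < n)%N ->
  (forall k j, G k j = G j k) ->
  (forall k j, 0 <= G k j) ->
  network_connected G ->
  (forall k, 0 < tau 0 k) ->
  (forall k, 0 < res 0 k) ->
  (forall k, 0 < imax 0 k) ->
  (forall k, 0 < alpha 0 k) ->
  (forall k, 0 < beta 0 k) ->
  semistable (system_mx G tau res imax alpha beta) ->
  is_solution (system_mx G tau res imax alpha beta)
    (fun t => col_mx (Im t) (Ud t)) ->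
  [/\ (* the inverse and the quotients in the formulas below are genuine *)
      shunt_mx G != 0 ->
        conductance_mx G \in unitmx /\ rc1_den G res imax beta != 0,
      shunt_mx G = 0 -> rc2_den beta != 0,
      forall k, Im t k 0 / imax 0 k @[t --> +oo] -->
        rc1 G res imax alpha beta (Im 0) (Ud 0) &
      Ud t - diag_mx res *m Im t @[t --> +oo] -->
        steady_voltage G res imax alpha beta (Im 0) (Ud 0)].
Proof.
move=> n0 sG G0 Gc tau0 res0 imax0 alpha0 beta0 ss sol.
have neq0 (d : 'rV[R]_n) : (forall k, 0 < d 0 k) -> forall k, d 0 k != 0.
  by move=> d0 k; rewrite gt_eqF.
have rc1_neq0 Gs := lt0r_neq0 (rc1_den_gt0 n0 sG G0 Gc Gs res0 imax0 beta0).
have rc2_neq0 : rc2_den beta != 0.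
  by apply: lt0r_neq0; apply: ones_invmx_diag_gt0 => // k; rewrite mxE.
have := ss _ sol.
set l := lim _; rewrite -[l]vsubmxK.
move: (usubmx l) (dsubmx l) => I U {l} zl.
have [EI ELI] := system_mx_ker (neq0 _ tau0) (neq0 _ beta0)
  (solution_limit_ker sol zl).
have [r Er] := info_laplacian_ker n0 Gc ELI.
have {Er} IE : I = r *: (diag_mx imax *m ones).
  by rewrite scalemxAr -Er mulKVmx// diag_mx_unit//; exact: neq0.
(* At the limit [L Ups^-1 I = 0], so the conserved quantity reduces to its voltage part. *)
have num : (ones^T *m invmx (diag_mx beta) *m U) 0 0 =
    ratio_num G imax alpha beta (Im 0) (Ud 0).
  have := conserved_functional sol
    (system_mx_conserved tau res imax alpha (neq0 _ beta0) sG) zl.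
  rewrite !mul_row_col -!mulmxA ELI !mulmx0 add0r => ->.
  by rewrite /ratio_num mulmxDr addrC !mulmxA.
have Ik k : I k 0 / imax 0 k = r.
  by rewrite IE mxE diag_mxE mxE mulr1 mulfK// neq0.
have Imr k : Im t k 0 / imax 0 k @[t --> +oo] --> r.
  rewrite -(Ik k); apply: cvgMr_tmp.
  have : col_mx (Im t) (Ud t) (lshift n k) 0 @[t --> +oo] -->
      col_mx I U (lshift n k) 0 by exact: (cvg_mxP _ _).1.
  rewrite col_mxEu; apply: cvg_trans; apply: near_eq_cvg.
  by apply: filterE => t; rewrite col_mxEu.
have volt : Ud t - diag_mx res *m Im t @[t --> +oo] -->
    U - diag_mx res *m I.
  have : row_mx (- diag_mx res) 1%:M *m col_mx (Im t) (Ud t) @[t --> +oo] -->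
      row_mx (- diag_mx res) 1%:M *m col_mx I U by exact: cvg_mulmx.
  rewrite mul_row_col mulNmx mul1mx addrC; apply: cvg_trans.
  apply: near_eq_cvg; apply: filterE => t.
  by rewrite mul_row_col mulNmx mul1mx addrC.
have [Gs|/negbNE/eqP Gs] := boolP (shunt_mx G != 0).
  have Yu := conductance_mx_unit sG G0 Gc Gs.
  have VE : U - diag_mx res *m I =
      r *: (invmx (conductance_mx G) *m diag_mx imax *m ones).
    by rewrite -mulmxA scalemxAr -IE [in RHS]EI mulKmx.
  (* Adding [R I] to the output voltage gives [U = r (Y^-1 + R) Ups 1], so [num] reads [r] times
     [rc1_den]. *)
  have rE : r = rc1 G res imax alpha beta (Im 0) (Ud 0).
    rewrite /rc1 Gs -num; apply: (canRL (mulfK (rc1_neq0 Gs))).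
    rewrite -[U](subrK (diag_mx res *m I)) VE IE -scalemxAr -scalerDr.
    by rewrite -scalemxAr mxE /rc1_den mulmxA -!mulmxDl -!mulmxA.
  split=> //; first by move=> ?; split; last exact: rc1_neq0.
  - by move=> k; rewrite -rE.
  - by rewrite /steady_voltage Gs -rE -VE.
have YE : conductance_mx G = branch_mx G.
  by rewrite /conductance_mx Gs add0r.
(* Without shunts [1^T Y = 0], so the limit currents sum to zero, while this sum is [r] times a
   positive number. *)
have r0 : r = 0.
  have : (ones^T *m I) 0 0 = 0.
    by rewrite EI YE mulmxA ones_branch_mx// mul0mx mxE.
  rewrite IE -scalemxAr mxE => /eqP; rewrite mulf_eq0 => /orP[/eqP//|].
  by rewrite gt_eqF// ones_dot_gt0// => k; rewrite diag_mxE mxE mulr1.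
have I0 : I = 0 by rewrite IE r0 scale0r.
(* With zero current the equilibrium equation is [Y U = 0], so [U] is a multiple of [ones]. *)
move: volt EI; rewrite I0 mulmx0 subr0 YE => volt.
move=> /esym/(branch_mx_ker n0 G0 Gc)[c Uc].
have cE : c = rc2 G imax alpha beta (Im 0) (Ud 0).
  rewrite /rc2 -num; apply: (canRL (mulfK rc2_neq0)).
  by rewrite Uc -scalemxAr mxE.
split=> //.
- by move=> k; rewrite /rc1 Gs eqxx -r0.
- by rewrite /steady_voltage Gs eqxx -cE -Uc.
Qed.
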